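(* Let $X$ be a regular topological space and let $\mathcal A$ and $\mathcal B$ be ideals of closed subsets of $X$. Then: (i) $\mathsf G_1(\mathcal O_X(\mathcal A), \Lambda_X(\mathcal B)) \leq_{\mathrm{II}} \mathsf G_1(\Omega_{MU_{\mathcal A}(X),\mathbf 0},\Omega_{MU_{\mathcal B}(X),\mathbf 0})$; (ii) $\mathsf G_1(\Omega_{MU_{\mathcal A}(X),\mathbf 0},\Omega_{MU_{\mathcal B}(X),\mathbf 0}) \leq_{\mathrm{II}} \mathsf G_1(\mathscr D_{MU_{\mathcal A}(X)},\Omega_{MU_{\mathcal B}(X),\mathbf 0})$; and (iii) if $X$ is $\mathcal A$-normal, then $\mathsf G_1(\mathscr D_{MU_{\mathcal A}(X)},\Omega_{MU_{\mathcal B}(X),\mathbf 0}) \leq_{\mathrm{II}} \mathsf G_1(\mathcal O_X(\mathcal A), \Lambda_X(\mathcal B))$. Thus, if $X$ is $\mathcal A$-normal, the three games $\mathsf G_1(\mathcal O_X(\mathcal A), \Lambda_X(\mathcal B))$, $\mathsf G_1(\Omega_{MU_{\mathcal A}(X),\mathbf 0},\Omega_{MU_{\mathcal B}(X),\mathbf 0})$ and $\mathsf G_1(\mathscr D_{MU_{\mathcal A}(X)},\Omega_{MU_{\mathcal B}(X),\mathbf 0})$ are equivalent.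
   Context: Games. For collections $\mathcal P,\mathcal Q$ of sets, in the game $\mathsf G_1(\mathcal P,\mathcal Q)$, at round $n\in\omega$ One chooses $P_n\in\mathcal P$ and Two responds with $x_n\in P_n$; Two wins if $\{x_n:n\in\omega\}\in\mathcal Q$, otherwise One wins. A strategy for One is $\sigma:(\bigcup\mathcal P)^{<\omega}\to\mathcal P$; it is winning if $\{x_n:n\in\omega\}\notin\mathcal Q$ whenever $x_n\in\sigma\langle x_k:k<n\rangle$ for all $n$; $\mathrm I\uparrow$ means One has a winning strategy. A strategy for Two is $\tau:\mathcal P^{<\omega}\to\bigcup\mathcal P$ (giving legal moves); it is winning if $\{\tau(P_0,\dots,P_n):n\in\omega\}\in\mathcal Q$ for all $(P_n)\in\mathcal P^\omega$; $\mathrm{II}\uparrow$ means Two has a winning strategy. A predetermined strategy for One is a function $\omega\to\mathcal P$ (depends only on the round); $\mathrm I\underset{\mathrm{pre}}{\uparrow}$ means One has a winning one. A Markov strategy for Two is a function $\mathcal P\times\omega\to\bigcup\mathcal P$ (depends only on One's latest move and the round); $\mathrm{II}\underset{\mathrm{mark}}{\uparrow}$ means Two has a winning one. For games $\mathcal G,\mathcal H$ of this type, $\mathcal G\leq_{\mathrm{II}}\mathcal H$ means that all four implications hold: $\mathrm{II}\underset{\mathrm{mark}}{\uparrow}\mathcal G\Rightarrow\mathrm{II}\underset{\mathrm{mark}}{\uparrow}\mathcal H$; $\mathrm{II}\uparrow\mathcal G\Rightarrow\mathrm{II}\uparrow\mathcal H$; $\mathrm I\not\uparrow\mathcal G\Rightarrow\mathrm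 I\not\uparrow\mathcal H$; $\mathrm I\underset{\mathrm{pre}}{\not\uparrow}\mathcal G\Rightarrow\mathrm I\underset{\mathrm{pre}}{\not\uparrow}\mathcal H$. They are equivalent, $\mathcal G\equiv\mathcal H$, if the four corresponding biconditionals hold. Ideals and covers. An ideal of closed subsets of $X$ is a family $\mathcal A$ of non-empty closed subsets of $X$, closed under unions of two members and containing $\{x\}$ for every $x\in X$; throughout, $X\notin\mathcal A$ is assumed for every ideal of closed sets. $X$ is $\mathcal A$-normal if for every $A\in\mathcal A$ and open $U\supseteq A$ there is an open $V$ with $A\subseteq V\subseteq\mathrm{cl}(V)\subseteq U$. $\mathcal O_X(\mathcal A)$ is the set of $\mathcal A$-covers: open covers $\mathscr U$ of $X$ with $\emptyset,X\notin\mathscr U$ such that every $A\in\mathcal A$ is contained in some $U\in\mathscr U$. $\Lambda_X(\mathcal A)$ is the set of $\mathcal A$-covers $\mathscr U$ such that $\{U\in\mathscr U:A\subseteq U\}$ is infinite for every $A\in\mathcal A$. For a space $Z$, $\mathscr D_Z$ is the set of dense subsets of $Z$, and for $z\in Z$, $\Omega_{Z,z}=\{S\subseteq Z: z\in\mathrm{cl}(S)\}$. Minimal usco maps. An usco map $\Phi$ from $X$ to $\mathbb R$ assigns to each $x\in X$ a non-empty compact set $\Phi(x)\subseteq\mathbb R$ so that $\{x:\Phi(x)\subseteq V\}$ is open for every open $V\subseteq\mathbb R$; it is minimal if its graph $\{(x,y):y\in\Phi(x)\}$ is $\subseteq$-minimal among graphs of usco maps from $X$ to $\mathbb R$. $MU(X)$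 is the set of minimal usco maps from $X$ to $\mathbb R$. For $\Phi\in MU(X)$, $A\subseteq X$, $\varepsilon>0$, $[\Phi;A,\varepsilon]$ is the set of $\Psi\in MU(X)$ such that for all $x\in A$ each point of $\Phi(x)$ is within distance $<\varepsilon$ of some point of $\Psi(x)$ and each point of $\Psi(x)$ is within distance $<\varepsilon$ of some point of $\Phi(x)$. $MU_{\mathcal A}(X)$ is $MU(X)$ with the topology in which $O$ is open iff for each $\Phi\in O$ there are $A\in\mathcal A$, $\varepsilon>0$ with $[\Phi;A,\varepsilon]\subseteq O$ (the topology of uniform convergence on members of $\mathcal A$). $\mathbf 0\in MU(X)$ is the constant map $x\mapsto\{0\}$. *)

(* Defs.v *)
From HB Require Import structures.
From mathcomp Require Import all_boot all_order all_algebra.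
From mathcomp Require Import all_classical all_reals all_analysis.

Set Implicit Arguments.
Unset Strict Implicit.
Unset Printing Implicit Defensive.

Import Order.TTheory GRing.Theory Num.Theory.
Import numFieldNormedType.Exports.

Local Open Scope classical_set_scope.
Local Open Scope ring_scope.

(* [G1 P Q] is the game in which, at round n, One plays [P_ n] in [P] and Two
   answers with a point [x n] of [P_ n]; Two wins iff [range x] is in [Q]. *)
Record game := G1 {
  game_point : choiceType;
  one_moves : set (set game_point);
  two_goal : set (set game_point) }.

Arguments one_moves : clear implicits.
Arguments two_goal : clear implicits.

Definition finseqs (T : eqType) (D : set T) : set (seq T) :=
  [set s | {in s, forall x, D x}].

Section Strategies.
Variable G : game.
Local Notation T := (game_point G).
Local Notation P := (one_moves G).
Local Notation Q := (two_goal G).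

Definition winning_one (sigma : seq T -> set T) : Prop :=
  set_fun (finseqs (\bigcup_(A in P) A)) P sigma /\
  forall x : nat -> T,
    (forall n, sigma (mkseq x n) (x n)) -> ~ Q (range x).

Definition winning_one_pre (sigma : nat -> set T) : Prop :=
  (forall n, P (sigma n)) /\
  forall x : nat -> T, (forall n, sigma n (x n)) -> ~ Q (range x).

(* The first clause is the codomain of the strategy, also on the empty
   sequence; the second one is legality of its answers. *)
Definition winning_two (tau : seq (set T) -> T) : Prop :=
  [/\ set_fun (finseqs P) (\bigcup_(A in P) A) tau,
      forall s A, finseqs P s -> P A -> A (tau (rcons s A)) &
      forall P_ : nat -> set T, (forall n, P (P_ n)) ->
        Q (range (fun n => tau (mkseq P_ n.+1)))].

Definition winning_two_mark (tau : set T -> nat -> T) : Prop :=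
  (forall A n, P A -> A (tau A n)) /\
  forall P_ : nat -> set T, (forall n, P (P_ n)) ->
    Q (range (fun n => tau (P_ n) n)).

Definition I_wins : Prop := exists sigma, winning_one sigma.
Definition I_wins_pre : Prop := exists sigma, winning_one_pre sigma.
Definition II_wins : Prop := exists tau, winning_two tau.
Definition II_wins_mark : Prop := exists tau, winning_two_mark tau.

End Strategies.

Definition le_II (G H : game) : Prop :=
  [/\ II_wins_mark G -> II_wins_mark H,
      II_wins G -> II_wins H,
      ~ I_wins G -> ~ I_wins H &
      ~ I_wins_pre G -> ~ I_wins_pre H].

Definition game_equiv (G H : game) : Prop :=
  [/\ II_wins_mark G <-> II_wins_mark H,
      II_wins G <-> II_wins H,
      ~ I_wins G <-> ~ I_wins H &
      ~ I_wins_pre G <-> ~ I_wins_pre H].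

(* Members of an ideal are non-empty and every singleton is a member, so
   [ideal_neq0] only excludes the empty space, over which the prescription
   [mu_open] below does not define a topology. *)
Record closed_ideal (X : topologicalType) := ClosedIdeal {
  ideal_sets : set (set X);
  ideal_closed : forall A, ideal_sets A -> closed A;
  ideal_mem_neq0 : forall A, ideal_sets A -> A !=set0;
  ideal_setU : forall A B, ideal_sets A -> ideal_sets B ->
    ideal_sets (A `|` B);
  ideal_set1 : forall x, ideal_sets [set x];
  ideal_setT : ~ ideal_sets setT;
  ideal_neq0 : ideal_sets !=set0 }.

Section Covers.
Variables (X : topologicalType) (A : closed_ideal X).

Definition ideal_normal : Prop :=
  forall (F U : set X), ideal_sets A F -> open U -> F `<=` U ->
    exists V, [/\ open V, F `<=` V & closure V `<=` U].

Definition ideal_covers : set (set (set X)) :=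
  [set C | [/\ (forall U, C U -> open U) /\ \bigcup_(U in C) U = setT,
               ~ C set0, ~ C setT &
               forall F, ideal_sets A F -> exists2 U, C U & F `<=` U]].

Definition ideal_large_covers : set (set (set X)) :=
  [set C | ideal_covers C /\
           forall F, ideal_sets A F -> infinite_set [set U | C U /\ F `<=` U]].

End Covers.

Definition dense_sets (Z : topologicalType) : set (set Z) :=
  [set S | dense S].

Definition Omega_at (Z : topologicalType) (z : Z) : set (set Z) :=
  [set S | closure S z].

Section Usco.
Variables (R : realType) (X : topologicalType).

Definition usco (Phi : X -> set R) : Prop :=
  [/\ forall x, Phi x !=set0,
      forall x, compact (Phi x) &
      forall V : set R, open V -> open [set x | Phi x `<=` V]].

Definition graph_of (Phi : X -> set R) : set (X * R) :=
  [set p | Phi p.1 p.2].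

Definition minimal_usco (Phi : X -> set R) : Prop :=
  usco Phi /\
  forall Psi, usco Psi -> graph_of Psi `<=` graph_of Phi ->
    graph_of Psi = graph_of Phi.

Record MU := MkMU {
  mu_fun :> X -> set R;
  mu_minimal : minimal_usco mu_fun }.

HB.instance Definition _ := gen_eqMixin MU.
HB.instance Definition _ := gen_choiceMixin MU.

Definition mu_nbhd (Phi : MU) (A : set X) (e : R) : set MU :=
  [set Psi : MU | forall x, A x ->
    (forall s, Phi x s -> exists2 t, Psi x t & `|s - t| < e) /\
    (forall t, Psi x t -> exists2 s, Phi x s & `|t - s| < e)].

Lemma cst0_minimal_usco : minimal_usco (fun _ : X => [set 0 : R]).
Proof.
split.
  split=> [x|x|V oV]; [by exists 0 | exact: compact_set1 |].
  have [V0|nV0] := pselect (V 0).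
    rewrite (_ : [set _ | _] = setT); first exact: openT.
    by apply/seteqP; split=> // x _ _ ->.
  rewrite (_ : [set _ | _] = set0); first exact: open0.
  by apply/seteqP; split=> // x /= /(_ 0 erefl).
move=> Psi [Psi0 _ _] sub; apply/seteqP; split=> // -[x y] y0.
have [z Psiz] := Psi0 x; have z0 : z = 0 := sub (x, z) Psiz.
by rewrite /graph_of /= (y0 : y = 0) -z0.
Qed.

Definition mu0 : MU := MkMU cst0_minimal_usco.

End Usco.

(* [MUtop R A] is [MU R X] with the topology of uniform convergence on the
   members of the ideal [A]. *)
Definition MUtop (R : realType) (X : topologicalType) (A : closed_ideal X) :
  Type := MU R X.

Section MUtopology.
Variables (R : realType) (X : topologicalType) (A : closed_ideal X).

HB.instance Definition _ := Choice.on (MUtop R A).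

Definition mu_open : set (set (MUtop R A)) :=
  [set O | forall Phi, O Phi ->
    exists F, exists e : R, [/\ ideal_sets A F, 0 < e & mu_nbhd Phi F e `<=` O]].

Let mu_openT : mu_open setT.
Proof. by move=> Phi _; have [F AF] := ideal_neq0 A; exists F, 1. Qed.

Let mu_nbhdS (Phi : MU R X) (F F' : set X) (e e' : R) :
  F' `<=` F -> e <= e' -> mu_nbhd Phi F e `<=` mu_nbhd Phi F' e'.
Proof.
move=> sF ee' Psi h x /sF/h[h1 h2]; split=> [s /h1|t /h2] [u hu lu];
  by exists u => //; exact: lt_le_trans ee'.
Qed.

Let mu_openI : setI_closed mu_open.
Proof.
move=> O1 O2 o1 o2 Phi [/o1[F1 [e1 [A1 e1_gt0 s1]]] /o2[F2 [e2 [A2 e2_gt0 s2]]]].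
exists (F1 `|` F2), (Num.min e1 e2); split.
- exact: ideal_setU.
- by rewrite lt_min e1_gt0.
- move=> Psi h; split.
  + by apply/s1/(mu_nbhdS _ _ h); [exact: subsetUl | rewrite ge_min lexx].
  + by apply/s2/(mu_nbhdS _ _ h); [exact: subsetUr | rewrite ge_min lexx orbT].
Qed.

Let mu_open_bigU (I : Type) (f : I -> set (MUtop R A)) :
  (forall i, mu_open (f i)) -> mu_open (\bigcup_i f i).
Proof.
move=> fo Phi [i _ /fo[F [e [AF e0 s]]]]; exists F, e; split=> //.
by move=> Psi /s ?; exists i.
Qed.

HB.instance Definition _ :=
  isOpenTopological.Build (MUtop R A) mu_openT mu_openI mu_open_bigU.

Lemma mu_openE : @open (MUtop R A) = mu_open.
Proof. by []. Qed.

End MUtopology.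

Section Games.
Variables (R : realType) (X : topologicalType) (A B : closed_ideal X).

Definition cover_game : game :=
  @G1 (set X) (ideal_covers A) (ideal_large_covers B).

(* One plays with respect to the topology given by [A], while Two's goal
   refers to the one given by [B]; both live on the same set [MU R X]. *)
Definition Omega_game : game :=
  @G1 (MU R X) (@Omega_at (MUtop R A) (mu0 R X))
               (@Omega_at (MUtop R B) (mu0 R X)).

Definition dense_game : game :=
  @G1 (MU R X) (@dense_sets (MUtop R A))
               (@Omega_at (MUtop R B) (mu0 R X)).

End Games.

(* Main.v *)
Require Import Defs.
From mathcomp Require Import all_boot all_order all_algebra.
From mathcomp Require Import all_classical all_reals all_analysis.

(** All four implications of [le_II G H] follow from one device: a map [TI n]
    turning every move of One in [H] into a move of One in [G] at the same
    round, together with a map [TII n] turning Two's answers in [G] back into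
    legal answers in [H], such that winning runs of Two are carried to winning
    runs of Two (Lemma [translation]).  Three such translations are needed.

    From covers to neighbourhoods of the zero map: at round [n], a set [S] of
    usco maps with zero in its closure becomes the cover of [X] by the sets
    where the values of a map of [S] lie in ]-1/(n+1), 1/(n+1)[, which are
    open by semicontinuity.  If Two's answers form a large cover, then each
    [F] in [B] is contained in the answers of infinitely many rounds, hence of
    rounds with 1/(n+1) as small as wanted, and there the corresponding map is
    uniformly small over [F].

    From neighbourhoods to dense sets: a dense set has zero in its closure.

    From dense sets to covers, under [A]-normality: a cover [C] becomes the set
    of maps that are constantly 1 outside some member of [C].  This set is
    dense: given [Phi] and [F] in [A], choose [U] in [C] containing [F] and an
    open [V] with F in V and cl V in U; a minimal usco map equal to [Phi] over
    [V] and to 1 outside cl V (Lemma [mu_glue]) is as close to [Phi] over [F]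
    as wanted and is in the set.  If the maps chosen by Two accumulate at zero,
    then each [F] in [B] admits a chosen map whose values over [F] avoid 1, so
    [F] lies in the member of the cover attached to that map.  These members
    thus form a [B]-cover, and every [B]-cover is large
    (Lemma [ideal_cover_large]). *)

Set Implicit Arguments.
Unset Strict Implicit.
Unset Printing Implicit Defensive.

Import Order.TTheory GRing.Theory Num.Theory.
Import numFieldNormedType.Exports.

Local Open Scope classical_set_scope.
Local Open Scope ring_scope.

(** * Translating strategies between games *)

Section Translation.
Variables (G H : game) (TI : nat -> set (game_point H) -> set (game_point G))
  (TII : nat -> game_point G -> set (game_point H) -> game_point H).
Hypothesis TI_move : forall n B, one_moves H B -> one_moves G (TI n B).
Hypothesis TII_legal : forall n B x,
  one_moves H B -> TI n B x -> B (TII n x B).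
Hypothesis TII_goal : forall B x, (forall n, one_moves H (B n)) ->
  (forall n, TI n (B n) (x n)) -> two_goal G (range x) ->
  two_goal H (range (fun n => TII n (x n) (B n))).

Let translate_II_mark : II_wins_mark G -> II_wins_mark H.
Proof.
move=> [tau [tauL tauW]]; exists (fun B n => TII n (tau (TI n B) n) B).
split=> [B n HB|B HB].
  by apply: TII_legal => //; apply: tauL; exact: TI_move.
apply: TII_goal => // [n|]; first by apply: tauL; exact: TI_move.
by apply: tauW => n; exact: TI_move.
Qed.

Definition translate_moves (s : seq (set (game_point H))) :
    seq (set (game_point G)) :=
  mkseq (fun i => TI i (nth set0 s i)) (size s).

Let translate_moves_rcons s B :
  translate_moves (rcons s B) = rcons (translate_moves s) (TI (size s) B).
Proof.
rewrite /translate_moves size_rcons mkseqS nth_rcons ltnn eqxx; congr rcons.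
apply/eq_in_map => i; rewrite mem_iota add0n /= => lis.
by rewrite nth_rcons lis.
Qed.

Let translate_moves_mkseq B n :
  translate_moves (mkseq B n) = mkseq (fun i => TI i (B i)) n.
Proof.
rewrite /translate_moves size_mkseq; apply/eq_in_map => i.
by rewrite mem_iota add0n /= => lin; rewrite nth_mkseq.
Qed.

Let finseqs_translate_moves s : finseqs (one_moves H) s ->
  finseqs (one_moves G) (translate_moves s).
Proof.
move=> Hs C /mapP[i]; rewrite mem_iota add0n /= => lis ->.
exact/TI_move/Hs/mem_nth.
Qed.

Let translate_II : \bigcup_(B in one_moves H) B !=set0 ->
  II_wins G -> II_wins H.
Proof.
move=> [b0 Hb0] [tau [_ tauL tauW]].
pose tau' s := if s is [::] then b0 else
  TII (size s).-1 (tau (translate_moves s)) (last set0 s).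
have tau'_rcons s B :
    tau' (rcons s B) = TII (size s) (tau (translate_moves (rcons s B))) B.
  have -> : tau' (rcons s B) = TII (size (rcons s B)).-1
      (tau (translate_moves (rcons s B))) (last set0 (rcons s B)).
    by case: s.
  by rewrite size_rcons last_rcons.
have tau'L s B : finseqs (one_moves H) s -> one_moves H B ->
    B (tau' (rcons s B)).
  move=> Hs HB; rewrite tau'_rcons; apply: TII_legal => //.
  rewrite translate_moves_rcons.
  by apply: tauL; [exact: finseqs_translate_moves | exact: TI_move].
exists tau'; split=> //.
- move=> s; case/lastP: s => [//|s B] HsB.
  have HB : one_moves H B by apply: HsB; rewrite mem_rcons mem_head.
  exists B => //; apply: tau'L => // C Cs.
  by apply: HsB; rewrite mem_rcons in_cons Cs orbT.
- move=> B HB.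
  have -> : (fun n => tau' (mkseq B n.+1)) =
      fun n => TII n (tau (mkseq (fun i => TI i (B i)) n.+1)) (B n).
    apply/funext => n; rewrite mkseqS tau'_rcons size_mkseq -mkseqS.
    by rewrite translate_moves_mkseq.
  apply: TII_goal => // [n|].
    rewrite mkseqS; apply: tauL; last exact: TI_move.
    by move=> C /mapP[i _ ->]; exact: TI_move.
  by apply: tauW => n; exact: TI_move.
Qed.

(** One follows in [G] the run of [H] in which Two's answers are the
    translations of the answers given so far in [G]. *)
Let translate_I : I_wins H -> I_wins G.
Proof.
move=> [sigma [sigmaP sigmaW]].
pose answers := foldl (fun l x => rcons l (TII (size l) x (sigma l))) [::].
pose move_H s := sigma (answers s).
have P0 : one_moves H (sigma [::]) by apply: sigmaP => y.
(* A history of [G] may contain moves that are not legal against the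
   translated strategy, and then [move_H] need not be a move of [H]. *)
exists (fun s => if `[< one_moves H (move_H s) >] then TI (size s) (move_H s)
          else TI 0 (sigma [::])).
split=> [s _|x xL]; first by case: asboolP => [?|_]; exact: TI_move.
pose y n := TII n (x n) (move_H (mkseq x n)).
have answersE n : answers (mkseq x n) = mkseq y n.
  elim: n => // n IHn; rewrite !mkseqS /answers foldl_rcons -/answers.
  by rewrite IHn size_mkseq -IHn.
have legal n : finseqs (\bigcup_(B in one_moves H) B) (mkseq y n).
  elim: n => [z //|n IHn] z; rewrite mkseqS mem_rcons in_cons.
  case/orP => [/eqP ->|]; last exact: IHn.
  have HB : one_moves H (move_H (mkseq x n)).
    by rewrite /move_H answersE; exact: sigmaP.
  exists (move_H (mkseq x n)) => //; apply: TII_legal => //.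
  by have := xL n; rewrite asboolT // size_mkseq.
have HB n : one_moves H (move_H (mkseq x n)).
  by rewrite /move_H answersE; exact/sigmaP/legal.
have xTI n : TI n (move_H (mkseq x n)) (x n).
  by have := xL n; rewrite asboolT // size_mkseq.
move=> Gx; apply: (sigmaW y) => [n|]; last exact: TII_goal.
by rewrite -answersE; exact: TII_legal.
Qed.

Let translate_I_pre : I_wins_pre H -> I_wins_pre G.
Proof.
move=> [sigma [sigmaP sigmaW]]; exists (fun n => TI n (sigma n)).
split=> [n|x xL Gx]; first exact: TI_move.
apply: (sigmaW (fun n => TII n (x n) (sigma n))) => [n|]; last exact: TII_goal.
exact: TII_legal.
Qed.

(** A strategy for Two with full information also takes a value on the empty
    history, so there has to be a move that it can return: hence the
    non-emptiness condition. *)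
Lemma translation : \bigcup_(B in one_moves H) B !=set0 -> le_II G H.
Proof.
move=> H0; split=> //; first exact: translate_II.
- by apply: contra_not => ?; exact: translate_I.
- by apply: contra_not => ?; exact: translate_I_pre.
Qed.

End Translation.

Lemma le_II_trans (G H K : game) : le_II G H -> le_II H K -> le_II G K.
Proof. by move=> [a b c d] [a' b' c' d']; split=> [/a|/b|/c|/d]. Qed.

Lemma le_II_anti (G H : game) : le_II G H -> le_II H G -> game_equiv G H.
Proof. by move=> [? ? ? ?] [? ? ? ?]; split; split. Qed.

(** * Covers *)

Section Covers.
Variables (X : topologicalType) (A : closed_ideal X).

(** No member [F] of the ideal is all of [X], so the complement of a point
    outside [F] is a proper open set containing [F]. *)
Lemma exists_ideal_cover : exists C, ideal_covers A C.
Proof.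
exists [set U | [/\ open U, U <> set0 & U <> setT]].
have cover F : ideal_sets A F ->
    exists2 U, [/\ open U, U <> set0 & U <> setT] & F `<=` U.
  move=> AF; have /existsNP[x nFx] : ~ (forall x, F x).
    move=> FT; apply: (@ideal_setT _ A); rewrite (_ : setT = F) //.
    by apply/seteqP; split=> // x _; exact: FT.
  exists (~` [set x]); last by move=> y Fy /= yx; apply: nFx; rewrite -yx.
  split.
  - by apply: closed_openC; apply: (@ideal_closed _ A); exact: ideal_set1.
  - have [y Fy] := ideal_mem_neq0 AF => /seteqP[/(_ y) + _]; apply=> yx.
    by apply: nFx; rewrite -yx.
  - by move=> /seteqP[_ /(_ x I)] /=; apply.
split=> //; [split=> [U []//|] | by case | by case].
apply/seteqP; split=> // x _.
by have [U CU xU] := cover _ (ideal_set1 A x); exists U => //; exact: xU.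
Qed.

(** If only finitely many members contained [F], adding to [F] one point
    outside each of them gives a member of the ideal that no member of the
    family contains. *)
Lemma ideal_cover_large C : ideal_covers A C -> ideal_large_covers A C.
Proof.
move=> CC; split=> // F AF finC; have [_ _ CnT Ccov] := CC.
have ext (s : seq (set X)) : (forall U, U \in s -> C U) ->
    exists2 F', ideal_sets A F' & F `<=` F' /\
      forall U, U \in s -> ~ F' `<=` U.
  elim: s => [|U s IHs] sC; first by exists F => //; split.
  have [|F' AF' [FF' nF']] := IHs.
    by move=> V Vs; apply: sC; rewrite in_cons Vs orbT.
  have CU : C U by apply: sC; rewrite mem_head.
  have /existsNP[x nUx] : ~ (forall x, U x).
    move=> UT; apply: CnT; rewrite (_ : setT = U) //.
    by apply/seteqP; split=> // x _; exact: UT.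
  exists (F' `|` [set x]); first by apply: ideal_setU => //; exact: ideal_set1.
  split=> [y /FF'|V]; first by left.
  rewrite in_cons => /orP[/eqP ->|Vs] sub; first by apply/nUx/sub; right.
  by apply: (nF' V) => // y ?; apply: sub; left.
have /finite_seqP[s sE] := finC.
have sC U : U \in s -> C U /\ F `<=` U.
  by move=> Us; have : [set` s] U by []; rewrite -sE.
have [|F' AF' [FF' nF']] := ext s; first by move=> U /sC[].
have [U CU F'U] := Ccov _ AF'.
apply: (nF' U) => //; have : [set U | C U /\ F `<=` U] U.
  by split=> //; exact: subset_trans F'U.
by rewrite sE.
Qed.

End Covers.

(** * Minimal usco maps *)

Section Usco.
Variables (R : realType) (X : topologicalType).
Implicit Types (Phi Psi Theta : X -> set R) (V W : set X).

(** A point outside the compact set [Phi x] has a closed ball around it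
    disjoint from [Phi x]; by semicontinuity, [Phi] avoids this ball near
    [x]. *)
Lemma usco_closed_graph Phi : usco Phi -> closed (graph_of Phi).
Proof.
move=> [_ Pcompact Pusc] [x y] cl; apply: contrapT => nPxy.
have cPx : closed (Phi x) := compact_closed (@Rhausdorff R) (Pcompact x).
have /nbhs_closedballP[e sube] : nbhs y (~` Phi x).
  exact: open_nbhs_nbhs (conj (closed_openC cPx) nPxy).
pose far := ~` closed_ball y e%:num.
have /cl : nbhs (x, y)
    ([set x' | Phi x' `<=` far] `*` closed_ball y e%:num).
  exists ([set x' | Phi x' `<=` far], closed_ball y e%:num) => //; split=> /=.
    apply: open_nbhs_nbhs; split.
      by apply: Pusc; apply: closed_openC; exact: closed_ball_closed.
    by move=> t Pt /sube.
  by apply/nbhs_closedballP; exists e.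
by case=> -[x' y'] [/= Px'y' [/(_ y' Px'y')]].
Qed.

(** A point where [Psi] takes values inside [W] has, by compactness of the
    value of [Theta], a neighbourhood over which the graph of [Psi] meets some
    uniform enlargement of that value only inside [W]; semicontinuity of
    [Theta] keeps the values of [Psi] in this enlargement. *)
Lemma closed_graph_usc Theta Psi (W : set R) : usco Theta ->
  closed (graph_of Psi) -> graph_of Psi `<=` graph_of Theta ->
  open W -> open [set x | Psi x `<=` W].
Proof.
move=> [_ Tcompact Tusc] cPsi sub oW; rewrite openE => x0 /= PsiW.
(* Quantifying over the [i.2]-ball around [y], and not only over [y], makes
   the covering property of [Theta x0] yield a uniform enlargement. *)
pose P (i : X * R) y :=
  forall y', `|y - y'| < i.2 -> Psi i.1 y' -> W y'.
have shrink y (N : set X) (r : R) : nbhs x0 N -> 0 < r ->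
    (forall x y', N x -> `|y - y'| < r -> Psi x y' -> W y') ->
    \forall y' \near y & i \near filter_prod (nbhs x0) 0^'+, P i y'.
  move=> x0N r0 NW; have r20 : 0 < r / 2 by rewrite divr_gt0.
  exists (ball y (r / 2), N `*` [set e | e < r / 2]) => /=.
    split; first exact: nbhsx_ballx.
    by exists (N, [set e | e < r / 2]) => //; split=> //; exact: nbhs_right_lt.
  move=> [y1 [x e]] [/= yy1 [Nx er]] y' y1y'; apply: NW => //.
  rewrite (splitr r); apply: le_lt_trans (ler_distD y1 _ _) _.
  by apply: ltrD => //; exact: lt_trans er.
have /compact_near_coveringP cov := Tcompact x0.
have [|[N E] /= [Nx0 E0] NEP] := cov _ (filter_prod (nbhs x0) 0^'+) P _.
  move=> y Ty; have [Wy|nWy] := pselect (W y).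
    have /nbhs_ballP[r /= r0 rW] : nbhs y W by exact: open_nbhs_nbhs.
    apply: (shrink y setT r) => // [|x y' _ yy' _]; first exact: filterT.
    exact: rW.
  have : nbhs (x0, y) (~` graph_of Psi).
    apply: open_nbhs_nbhs; split; first exact: closed_openC.
    by move=> /PsiW.
  case=> -[N M] /= [Nx0 /nbhs_ballP[r /= r0 rM]] NM.
  apply: (shrink y N r) => // x y' Nx yy' Pxy'.
  by case: (NM (x, y')) => //; split=> //; exact: rM.
have [e [Ee e0]] := filter_ex (filterI E0 (nbhs_right_gt 0)).
have oV : open (\bigcup_(y in Theta x0) ball y e).
  by apply: bigcup_open => y _; exact: ball_open.
have TV : nbhs x0 [set x | Theta x `<=` \bigcup_(y in Theta x0) ball y e].
  apply: open_nbhs_nbhs; split; first exact: Tusc.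
  by move=> y Ty; exists y => //; exact: ballxx.
apply: filterS (filterI Nx0 TV) => x [Nx TVx] y' Pxy'.
have [y Ty yy'] := TVx _ (sub (x, y') Pxy').
by apply: (NEP (x, e) (conj Nx Ee) y Ty).
Qed.

(** Minimality can be tested over an open set: replacing [Phi] by the smaller
    [Psi] over [V] only leaves an usco map. *)
Lemma minimal_usco_local Phi Psi V : minimal_usco Phi -> usco Psi -> open V ->
  (forall x, V x -> Psi x `<=` Phi x) -> forall x, V x -> Psi x = Phi x.
Proof.
move=> [[P0 Pc Pusc] Pmin] [Q0 Qc Qusc] oV sub.
pose Phi' x := if `[< V x >] then Psi x else Phi x.
have sub' x : Phi' x `<=` Phi x.
  by rewrite /Phi'; case: asboolP => Vx y //; exact: sub.
have uPhi' : usco Phi'.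
  split=> [x|x|W oW]; rewrite /Phi'; [by case: asboolP..|].
  rewrite (_ : [set _ | _] =
      [set x | Phi x `<=` W] `|` (V `&` [set x | Psi x `<=` W])).
    by apply: openU; [exact: Pusc | apply: openI => //; exact: Qusc].
  apply/seteqP; split=> x /=; case: asboolP => Vx.
  - by move=> ?; right.
  - by move=> ?; left.
  - by case=> [PW|[]//]; exact: subset_trans (sub _ Vx) PW.
  - by case=> // -[].
have E := Pmin _ uPhi' (fun p => @sub' p.1 p.2).
move=> x Vx; apply/seteqP; split=> [|y Pxy]; first exact: sub.
have : graph_of Phi' (x, y) by rewrite E.
by rewrite /graph_of /= /Phi' asboolT.
Qed.

(** Keeping the values of both maps over the boundary of [V] makes the glued
    map semicontinuous there, but in general not minimal. *)
Lemma usco_glue Phi Phi' V : usco Phi -> usco Phi' -> open V ->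
  usco (fun x => [set y | closure V x /\ Phi x y \/ ~ V x /\ Phi' x y]).
Proof.
move=> [P0 Pc Pusc] [P'0 P'c P'usc] oV; split=> [x|x|W oW].
- have [Vx|nVx] := pselect (V x).
    by have [y Py] := P0 x; exists y; left; split=> //; exact: subset_closure.
  by have [y P'y] := P'0 x; exists y; right.
- rewrite (_ : [set _ | _] = (if `[< closure V x >] then Phi x else set0) `|`
      (if `[< V x >] then set0 else Phi' x)).
    by apply: compactU; case: ifP => _ //; exact: compact0.
  apply/seteqP; split=> y /=; case: asboolP => ?; case: asboolP => ?.
  + by case=> [[]|[]]; left.
  + by case=> [[]|[]]; [left|right].
  + by case=> [[]|[]].
  + by case=> [[]|[]] //; right.
  + by case=> //; left.
  + by case=> //; [left|right].
  + by case.
  + by case=> //; right.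
- rewrite (_ : [set _ | _] = ([set x | Phi x `<=` W] `|` ~` closure V) `&`
      ([set x | Phi' x `<=` W] `|` V)).
    apply: openI; apply: openU => //; [exact: Pusc| |exact: P'usc].
    by apply: closed_openC; exact: closed_closure.
  apply/seteqP; split=> x /=.
    move=> TW; split.
      have [cVx|] := pselect (closure V x); last by right.
      by left=> y Py; apply: TW; left.
    by have [|nVx] := pselect (V x); [right | left=> y Py; apply: TW; right].
  by case=> -[P1|?] [P2|?] y [] [] // _;
    [move=> /P1|move=> /P2|move=> /P1|move=> /P2].
Qed.

(** The graph of [Psi] is the closure of its part over [V] and over the
    exterior of [V], where the values are prescribed.  The map of [usco_glue]
    bounds [Psi], so [closed_graph_usc] makes it usco.  It is minimal, since a
    smaller usco map agrees with it wherever the values are prescribed, by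
    [minimal_usco_local], and has a closed graph. *)
Lemma mu_glue (Phi Phi' : MU R X) V : open V -> exists Psi : MU R X,
  (forall x, V x -> Psi x = Phi x) /\
  (forall x, ~ closure V x -> Psi x = Phi' x).
Proof.
move=> oV; have [uP _] := mu_minimal Phi; have [uP' _] := mu_minimal Phi'.
set Theta : X -> set R :=
  fun x => [set y | closure V x /\ Phi x y \/ ~ V x /\ Phi' x y].
have uT : usco Theta by exact: usco_glue.
pose G := [set p : X * R | V p.1 /\ Phi p.1 p.2 \/
                           ~ closure V p.1 /\ Phi' p.1 p.2].
pose Psi x := [set y | closure G (x, y)].
have oV' : open (~` closure V) by apply: closed_openC; exact: closed_closure.
have graphPsi : graph_of Psi = closure G by apply/seteqP; split=> -[].
have cPsi : closed (graph_of Psi) by rewrite graphPsi; exact: closed_closure.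
have PsiTheta : graph_of Psi `<=` graph_of Theta.
  rewrite graphPsi closureE; apply: smallest_sub.
    exact: usco_closed_graph.
  move=> [x y] /= [[Vx Py]|[nVx P'y]].
    by left; split=> //; exact: subset_closure.
  by right; split=> //; apply: contra_not nVx; exact: subset_closure.
have PsiV x : V x -> Psi x = Phi x.
  move=> Vx; apply/seteqP; split=> y.
    by move=> /(PsiTheta (x, y))[[]|[]].
  by move=> Py; apply: subset_closure; left.
have PsiV' x : ~ closure V x -> Psi x = Phi' x.
  move=> Vx; apply/seteqP; split=> y.
    by move=> /(PsiTheta (x, y))[[]|[]].
  by move=> Py; apply: subset_closure; right.
have Psi_usc (W : set R) : open W -> open [set x | Psi x `<=` W].
  exact: closed_graph_usc uT cPsi PsiTheta.
have uPsi : usco Psi.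
  split=> // x.
    have [cVx|nVx] := pselect (closure V x); last first.
      by rewrite PsiV' //; case: uP' => + _ _; exact.
    apply: contrapT => /set0P/negP; rewrite negbK => /eqP Px0.
    have /cVx[x' [Vx' /=]] : nbhs x [set x | Psi x `<=` set0].
      apply: open_nbhs_nbhs; split; last by rewrite /= Px0.
      by apply: Psi_usc; exact: open0.
    rewrite PsiV // => Px'0; have [y Py] : Phi x' !=set0 by case: uP.
    exact: Px'0 Py.
  have [_ Tc _] := uT; apply: (subclosed_compact _ (Tc x)).
    apply: (@preimage_closed _ _ (fun y => (x, y))); last exact: closed_closure.
    move=> y _; apply: (@cvg_pair _ _ _ (nbhs y) (nbhs x) (nbhs y)) => /=.
      exact: cvg_cst.
    exact: cvg_id.
  by move=> y /(PsiTheta (x, y)).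
have minPsi : minimal_usco Psi.
  split=> // Psi' uPsi' sub; apply/seteqP; split=> //.
  rewrite graphPsi closureE; apply: smallest_sub.
    exact: usco_closed_graph.
  move=> [x y] [[/= Vx Py]|[/= Vx Py]]; rewrite /graph_of /=.
    rewrite (minimal_usco_local (mu_minimal Phi) uPsi' oV) // => x' Vx' y' ?.
    by rewrite -PsiV //; exact: (sub (x', y')).
  rewrite (minimal_usco_local (mu_minimal Phi') uPsi' oV') // => x' Vx' y' ?.
  by rewrite -PsiV' //; exact: (sub (x', y')).
by exists (MkMU minPsi).
Qed.

Lemma cst_minimal_usco (c : R) : minimal_usco (fun _ : X => [set c]).
Proof.
split.
  split=> [x|x|V oV]; [by exists c | exact: compact_set1 |].
  have [Vc|nVc] := pselect (V c).
    rewrite (_ : [set _ | _] = setT); first exact: openT.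
    by apply/seteqP; split=> // x _ _ ->.
  rewrite (_ : [set _ | _] = set0); first exact: open0.
  by apply/seteqP; split=> // x /= /(_ c erefl).
move=> Psi [Psi0 _ _] sub; apply/seteqP; split=> // -[x y] /= yc.
have [z Pz] := Psi0 x; have zc : z = c := sub (x, z) Pz.
by rewrite /graph_of /= (yc : y = c) -zc.
Qed.

Definition mu_cst (c : R) : MU R X := MkMU (cst_minimal_usco c).

End Usco.

(** * Density in the spaces of minimal usco maps *)

Section Density.
Variables (R : realType) (X : topologicalType).

Definition small_at (Phi : MU R X) (e : R) : set X :=
  [set x | Phi x `<=` [set y | `|y| < e]].

Lemma small_at_open Phi e : open (small_at Phi e).
Proof.
have [[_ _ usc] _] := mu_minimal Phi; apply: usc.
rewrite (_ : [set _ | _] = ball 0 e); first exact: ball_open.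
by rewrite -ball_normE; apply/seteqP; split=> y; rewrite /= sub0r normrN.
Qed.

(** The sets [mu_nbhd (mu0 R X) F e] form a base of neighbourhoods of the zero
    map, although they need not be open. *)
Lemma Omega_at_mu0P (A : closed_ideal X) (S : set (MU R X)) :
  @Omega_at (MUtop R A) (mu0 R X) S <->
  forall F e, ideal_sets A F -> 0 < e ->
    exists2 Phi, S Phi & F `<=` small_at Phi e.
Proof.
split=> [cl F e AF e0|small N].
  (* The existential over [d] makes the set open: a map within half of the
     slack [e - d] of [Phi] is still small. *)
  pose O := [set Phi : MUtop R A | exists2 d, d < e & F `<=` small_at Phi d].
  have oO : open O.
    rewrite mu_openE => Phi [d de Fd].
    have h0 : 0 < (e - d) / 2 by rewrite divr_gt0 // subr_gt0.
    exists F, ((e - d) / 2); split=> // Psi close.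
    exists (d + (e - d) / 2).
      by rewrite -ltrBrDl ltr_pdivrMr // ltr_pMr ?ltr1n ?subr_gt0.
    move=> x Fx t /(close x Fx).2[s Ps ts] /=.
    rewrite -(subrK s t) addrC; apply: le_lt_trans (ler_normD _ _) _.
    by apply: ltrD => //; exact: Fd Ps.
  have /cl[Phi [SPhi [d de Fd]]] : nbhs (mu0 R X : MUtop R A) O.
    apply: open_nbhs_nbhs; split=> //; exists (e / 2).
      by rewrite ltr_pdivrMr // ltr_pMr // ltr1n.
    by move=> x _ y /= ->; rewrite normr0 divr_gt0.
  by exists Phi => // x /Fd Px y /Px /= /lt_trans; apply.
rewrite nbhsE; case=> O [oO O0] ON.
move: oO; rewrite mu_openE => /(_ _ O0)[F [e [AF e0 sub]]].
have [Phi SPhi Fe] := small F e AF e0; exists Phi; split=> //.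
apply/ON/sub => x Fx; have [[P0 _ _] _] := mu_minimal Phi.
split=> [s ->|t Pt]; last by exists 0 => //; rewrite subr0; exact: Fe Pt.
have [t Pt] := P0 x; exists t => //; rewrite sub0r normrN; exact: Fe Pt.
Qed.

Lemma dense_Omega_at (A : closed_ideal X) (S : set (MU R X)) :
  @dense_sets (MUtop R A) S -> @Omega_at (MUtop R A) (mu0 R X) S.
Proof.
move=> dS N; rewrite nbhsE; case=> O [oO O0] ON.
have [|Phi [/ON NPhi SPhi]] := dS O _ oO; first by exists (mu0 R X).
by exists Phi.
Qed.

Definition cst_outside (C : set (set X)) : set (MU R X) :=
  [set Phi | exists2 U, C U & forall x, ~ U x -> Phi x = [set 1]].

Lemma cst_outside_dense (A : closed_ideal X) C : ideal_normal A ->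
  ideal_covers A C -> @dense_sets (MUtop R A) (cst_outside C).
Proof.
move=> Anormal [[Copen _] _ _ Ccov] O [Phi OPhi].
rewrite mu_openE => /(_ _ OPhi)[F [e [AF e0 sub]]].
have [U CU FU] := Ccov F AF.
have [V [oV FV VU]] := Anormal F U AF (Copen U CU) FU.
have [Psi [PsiV PsinV]] := mu_glue Phi (mu_cst X 1) oV.
exists Psi; split; last first.
  by exists U => // x nUx; rewrite PsinV // => /VU.
apply: sub => x /FV Vx; rewrite PsiV //.
by split=> s Ps; exists s => //; rewrite subrr normr0.
Qed.

End Density.

(** * The three games *)

Section Games.
Variables (R : realType) (X : topologicalType) (A B : closed_ideal X).

Lemma cover_le_Omega : le_II (cover_game A B) (Omega_game R A B).
Proof.
have [C0 AC0] := exists_ideal_cover A.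
pose rad n : R := n.+1%:R^-1.
have rad0 n : 0 < rad n by rewrite invr_gt0.
pose whole n (S : set (MU R X)) :=
  exists2 Phi, S Phi & small_at Phi (rad n) = setT.
(* [X] itself may not be a member of a cover.  If some map of [S] is small
   everywhere then Two can answer with it, and any cover will do. *)
pose TI n (S : set (MU R X)) := if `[< whole n S >] then C0 else
  [set U | U <> set0 /\ exists2 Phi, S Phi & U = small_at Phi (rad n)].
pose TII n (U : set X) (S : set (MU R X)) : MU R X :=
  xget (mu0 R X) [set Phi | S Phi /\ U `<=` small_at Phi (rad n)].
have TII_spec n S U : TI n S U ->
    S (TII n U S) /\ U `<=` small_at (TII n U S) (rad n).
  rewrite /TI => TIU.
  suff : [set Phi | S Phi /\ U `<=` small_at Phi (rad n)] !=set0.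
    exact: xgetPex.
  move: TIU; case: asboolP => [[Phi SPhi PhiT] _|_ [_ [Phi SPhi ->]]].
    by exists Phi; split=> //; rewrite PhiT.
  by exists Phi; split.
apply: (@translation (cover_game A B) (Omega_game R A B) TI TII).
- move=> n S /= /Omega_at_mu0P small; rewrite /TI; case: asboolP => // nwhole.
  have cov F : ideal_sets A F -> exists2 U,
      U <> set0 /\ (exists2 Phi, S Phi & U = small_at Phi (rad n)) & F `<=` U.
    move=> AF; have [Phi SPhi Fsmall] := small F (rad n) AF (rad0 n).
    exists (small_at Phi (rad n)) => //; split; last by exists Phi.
    have [x /Fsmall xs] := ideal_mem_neq0 AF.
    by move=> /seteqP[/(_ x xs)].
  split=> //.
  + split=> [U [_ [Phi _ ->]]|]; first exact: small_at_open.
    apply/seteqP; split=> // x _.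
    by have [U CU xU] := cov _ (ideal_set1 A x); exists U => //; exact: xU.
  + by case.
  + by case=> _ [Phi SPhi PhiT]; apply: nwhole; exists Phi.
- by move=> n S U _ /TII_spec[].
- move=> S U _ US [_ large]; apply/Omega_at_mu0P => F e BF e0.
  have [N _ Nrad] := near_infty_natSinv_lt (PosNum e0).
  have [n [Nn FU]] : exists n, (N <= n)%N /\ F `<=` U n.
    apply: contrapT => none; apply: (large F BF).
    apply: sub_finite_set (finite_image U (finite_II N)) => _ [[n _ <-] FU].
    exists n => //=; rewrite ltnNge; apply/negP => Nn.
    by apply: none; exists n.
  have [_ small] := TII_spec _ _ _ (US n).
  exists (TII n (U n) (S n)); first by exists n.
  move=> x /FU/small Px y /Px /= /lt_trans; apply; exact: Nrad.
- exists (mu0 R X); exists setT => //; apply/Omega_at_mu0P => F e _ e0.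
  by exists (mu0 R X) => // x _ y /= ->; rewrite normr0.
Qed.

Lemma Omega_le_dense : le_II (Omega_game R A B) (dense_game R A B).
Proof.
apply: (@translation (Omega_game R A B) (dense_game R A B)
  (fun _ S => S) (fun _ Phi _ => Phi)) => //.
- by move=> _ S; exact: dense_Omega_at.
- exists (mu0 R X); exists setT => //.
  by move=> O [Phi OPhi] _; exists Phi.
Qed.

Lemma dense_le_cover : ideal_normal A ->
  le_II (dense_game R A B) (cover_game A B).
Proof.
move=> Anormal.
pose TII (n : nat) (Phi : MU R X) (C : set (set X)) : set X :=
  xget set0 [set U | C U /\ forall x, ~ U x -> Phi x = [set 1]].
have TII_spec n C Phi : cst_outside C Phi ->
    C (TII n Phi C) /\ forall x, ~ TII n Phi C x -> Phi x = [set 1].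
  move=> [U CU PhiU].
  suff : [set U | C U /\ forall x, ~ U x -> Phi x = [set 1]] !=set0.
    exact: xgetPex.
  by exists U.
apply: (@translation (dense_game R A B) (cover_game A B)
  (fun _ C => cst_outside C) TII).
- by move=> n C AC; exact: (cst_outside_dense Anormal).
- by move=> n C Phi _ /TII_spec - /(_ n)[].
- move=> C Phi AC PhiC /Omega_at_mu0P small.
  have mem n := (TII_spec n _ _ (PhiC n)).1.
  have cst n := (TII_spec n _ _ (PhiC n)).2.
  apply: ideal_cover_large.
  have cov F : ideal_sets B F ->
      exists2 U, range (fun n => TII n (Phi n) (C n)) U & F `<=` U.
    move=> BF; have [_ [n _ <-] Fsmall] := small F 1 BF ltr01.
    exists (TII n (Phi n) (C n)); first by exists n.
    move=> x Fx; apply: contrapT => /cst Phi1.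
    by have := Fsmall x Fx 1; rewrite Phi1 /= normr1 ltxx => /(_ erefl).
  split=> //.
  + split=> [_ [n _ <-]|].
      by have [[Copen _] _ _ _] := AC n; exact/Copen/mem.
    apply/seteqP; split=> // x _.
    by have [U ? xU] := cov _ (ideal_set1 B x); exists U => //; exact: xU.
  + by case=> n _ E; have [_ + _ _] := AC n; apply; rewrite -E.
  + by case=> n _ E; have [_ _ + _] := AC n; apply; rewrite -E.
- have [C AC] := exists_ideal_cover A; have [F AF] := ideal_neq0 A.
  by have [_ _ _ /(_ F AF)[U CU _]] := AC; exists U; exists C.
Qed.

End Games.

Theorem theorem36 (R : realType) (X : topologicalType)
    (A B : closed_ideal X) (Xreg : regular_space X) :
  [/\ le_II (cover_game A B) (Omega_game R A B),
      le_II (Omega_game R A B) (dense_game R A B),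
      ideal_normal A -> le_II (dense_game R A B) (cover_game A B) &
      ideal_normal A ->
        [/\ game_equiv (cover_game A B) (Omega_game R A B),
            game_equiv (Omega_game R A B) (dense_game R A B) &
            game_equiv (cover_game A B) (dense_game R A B)]].
Proof.
have cO := cover_le_Omega R A B; have Od := Omega_le_dense R A B.
split=> // Anormal; first exact: dense_le_cover.
have dc := dense_le_cover R B Anormal.
split; apply: le_II_anti => //.
- exact: le_II_trans Od dc.
- exact: le_II_trans dc cO.
- exact: le_II_trans cO Od.
Qed.
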